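(* The following hold. (1) Let $X$ be a set of reals. Then $X$ satisfies $\mathsf{S}_{[0,2)}(\mathcal{B}_{\mathrm{T}},\mathcal{B}_{\mathrm{T}})$ if, and only if, for each Borel function $\Psi:X\to\{0,1\}^{\mathbb{N}\times\mathbb{N}}$: if $\Psi[X]$ is a $\tau$-family, then $\Psi[X]$ is semi $\tau$-diagonalizable. The corresponding clopen case also holds: $X$ satisfies $\mathsf{S}_{[0,2)}(C_{\mathrm{T}},C_{\mathrm{T}})$ if, and only if, for each continuous function $\Psi:X\to\{0,1\}^{\mathbb{N}\times\mathbb{N}}$: if $\Psi[X]$ is a $\tau$-family, then $\Psi[X]$ is semi $\tau$-diagonalizable. (2) The minimal cardinality of a $\tau$-family $\mathcal{A}\subseteq\{0,1\}^{\mathbb{N}\times\mathbb{N}}$ that is not semi $\tau$-diagonalizable is at least $\min\{\mathfrak{s},\mathfrak{b},\mathfrak{od}\}$. (3) $\min\{\mathfrak{s},\mathfrak{b},\mathfrak{od}\}\le \mathsf{non}(\mathsf{S}_{[0,2)}(\mathcal{B}_{\mathrm{T}},\mathcal{B}_{\mathrm{T}}))=\mathsf{non}(\mathsf{S}_{[0,2)}(\mathrm{T},\mathrm{T}))=\mathsf{non}(\mathsf{S}_{[0,2)}(C_{\mathrm{T}},C_{\mathrm{T}}))$.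
   Context: A set of reals is an infinite, zero-dimensional, separable metrizable topological space $X$. A cover of $X$ is a family $\mathcal{U}$ of subsets of $X$ with $X\notin\mathcal{U}$ and $X=\bigcup\mathcal{U}$. A cover $\mathcal{U}$ of $X$ is a large cover if for each $x\in X$ the set $\{U\in\mathcal{U}:x\in U\}$ is infinite. It is a $\tau$-cover if it is a large cover and for all $x,y\in X$, at least one of the sets $\{U\in\mathcal{U}:x\in U,\ y\notin U\}$, $\{U\in\mathcal{U}:y\in U,\ x\notin U\}$ is finite. $\mathrm{T}$, $C_{\mathrm{T}}$, $\mathcal{B}_{\mathrm{T}}$ denote the collections of all countable $\tau$-covers of $X$ by open, clopen, and Borel sets, respectively. For collections $\mathscr{A},\mathscr{B}$ of covers of $X$, $X$ satisfies $\mathsf{S}_{[0,2)}(\mathscr{A},\mathscr{B})$ if for each sequence $\langle\mathcal{U}_n:n\in\mathbb{N}\rangle$ of members of $\mathscr{A}$ there exist subsets $\mathcal{F}_n\subseteq\mathcal{U}_n$ with $0\le|\mathcal{F}_n|<2$ for each $n$, such that $\bigcup_n\mathcal{F}_n\in\mathscr{B}$. For a property $P$ of sets of reals, $\mathsf{non}(P)$ is the minimal cardinality of a set of reals not satisfying $P$. $\exists^\infty n$ means ''for infinitely many $n$''; $\forall^\infty n$ means ''for all but finitely many $n$''. The space $\{0,1\}^{\mathbb{N}\times\mathbb{N}}$ carries the product topology. A family $\mathcal{A}\subseteq\{0,1\}^{\mathbb{N}\times\mathbb{N}}$ is a $\tau$-family if: (i) for each $A\in\mathcal{A}$ and each $n$,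 $(\exists^\infty m)\ A(n,m)=1$; (ii) for all $A,B\in\mathcal{A}$ and each $n$, either $(\forall^\infty m)\ A(n,m)\le B(n,m)$, or $(\forall^\infty m)\ B(n,m)\le A(n,m)$. A family $\mathcal{A}\subseteq\{0,1\}^{\mathbb{N}\times\mathbb{N}}$ is semi $\tau$-diagonalizable if there exists a partial function $g:\mathbb{N}\to\mathbb{N}$ such that: (i) for each $A\in\mathcal{A}$, $(\exists^\infty n\in\mathrm{dom}(g))\ A(n,g(n))=1$; (ii) for all $A,B\in\mathcal{A}$, either $(\forall^\infty n\in\mathrm{dom}(g))\ A(n,g(n))\le B(n,g(n))$, or $(\forall^\infty n\in\mathrm{dom}(g))\ B(n,g(n))\le A(n,g(n))$. $\mathfrak{s}$ is the splitting number and $\mathfrak{b}$ is the (un)bounding number. $\mathfrak{od}$ is the minimal cardinality of a $\tau$-family $\mathcal{A}$ for which there is no function $g:\mathbb{N}\to\mathbb{N}$ such that for each $A\in\mathcal{A}$ there is $n$ with $A(n,g(n))=1$. *)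

(* Defs.v *)
From HB Require Import structures.
From mathcomp Require Import all_boot all_order all_algebra.
From mathcomp Require Import all_classical all_reals all_analysis.

Set Implicit Arguments.
Unset Strict Implicit.
Unset Printing Implicit Defensive.

Import Order.TTheory GRing.Theory Num.Theory.

Local Open Scope classical_set_scope.
Local Open Scope card_scope.
Local Open Scope ring_scope.

(* A cardinal is represented by any type of that cardinality; [min_card P] is
   a least element of the class [P] with respect to [#<=].  By [min_cardP] the
   default value is only taken when [P] is empty. *)
Definition least_card (P : Type -> Prop) (K : Type) : Prop :=
  P K /\ forall L : Type, P L -> [set: K] #<= [set: L].

Definition min_card (P : Type -> Prop) : Type :=
  match pselect (exists K, least_card P K) with
  | left h => sval (cid h)
  | right _ => False
  end.

Lemma least_type_ex (I : Type) (T : I -> Type) (i0 : I) :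
  exists i, forall j, [set: T i] #<= [set: T j].
Proof.
(* partial matchings between all the [T i] *)
pose inj (F : set (forall i : I, T i)) :=
  forall f g i, F f -> F g -> f i = g i -> f = g.
have [|F [Finj Fmax]] := @Zorn_bigcup _ inj.
  move=> C CS Ctot f g i [A CA Af] [B CB Bg] fg.
  have [AB|BA] := Ctot _ _ CA CB.
    by apply: (CS _ CB _ _ i) => //; exact: AB.
  by apply: (CS _ CA _ _ i) => //; exact: BA.
have [i Hi] : exists i : I, forall k : T i, exists2 f, F f & f i = k.
  apply: contrapT => /forallNP H.
  have {}H i : exists k : T i, forall f, F f -> f i <> k.
    have /existsNP[k Hk] := H i; exists k => f Ff fk.
    by apply: Hk; exists f.
  pose h (i : I) := sval (cid (H i)).
  have hP i f : F f -> f i <> h i by exact: (svalP (cid (H i))).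
  apply: (Fmax (F `|` [set h])); last first.
    move=> f g j [Ff|->] [Fg|->] // e.
    - exact: Finj e.
    - by case: (hP j f Ff).
    - by case: (hP j g Fg).
  split; first exact: subsetUl.
  by move=> /(_ h (or_intror erefl)) /(hP i0).
exists i => j.
have HF k : exists f, F f /\ f i = k by have [f Ff fk] := Hi k; exists f.
pose f k := sval (cid (HF k)).
have fP k : F (f k) /\ f k i = k by exact: (svalP (cid (HF k))).
have finj : {in [set: T i] &, injective (fun k => f k j)}.
  move=> k l _ _ e; have [Fk <-] := fP k; have [Fl <-] := fP l.
  by rewrite (Finj _ _ j Fk Fl e).
by rewrite -(card_le_eql (inj_card_eq finj)); exact: card_leT.
Qed.

Lemma card_le_total (K L : Type) :
  [set: K] #<= [set: L] \/ [set: L] #<= [set: K].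
Proof.
have [[] H] := least_type_ex (fun b : bool => if b then K else L) true.
  by left; exact: (H false).
by right; exact: (H true).
Qed.

(* The minimum is sought among the subsets of [K0] rather than in [P] itself,
   which keeps the universe constraints on [P] minimal. *)
Lemma least_card_ex (P : Type -> Prop) (K0 : Type) :
  P K0 -> exists K, least_card P K.
Proof.
move=> PK0.
pose Q (A : set K0) := exists2 L, P L & A #= [set: L].
have QT : Q [set: K0] by exists K0 => //; exact: card_eqxx.
have cT (A : set K0) : [set: {x : K0 | A x}] #= A.
  have vinj : {in [set: {x | A x}] &, injective (@sval K0 A)}.
    by move=> [x Ax] [y Ay] _ _ /= xy; exact: eq_exist.
  rewrite (card_eql (card_esym (inj_card_eq vinj))).
  rewrite [X in X #= _](_ : _ = A) ?card_eqxx//.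
  apply/seteqP; split=> [_ [[x Ax] _ <-]//|x Ax].
  by exists (exist _ x Ax).
have [[A [L PL AL]] H] := least_type_ex
  (fun i : {A : set K0 | Q A} => {x : K0 | sval i x}) (exist _ _ QT).
have HA (B : set K0) : Q B -> A #<= B.
  move=> QB; have /= := H (exist _ B QB).
  by rewrite (card_le_eql (cT _)) (card_le_eqr (cT _)).
exists L; split=> // M PM; rewrite -(card_le_eql AL).
have [KM|MK] := card_le_total K0 M.
  by apply: card_le_trans KM; exact: card_leT.
have /card_subP[B BM _] := MK.
by rewrite -(card_le_eqr BM); apply: HA; exists M.
Qed.

Lemma min_cardP (P : Type -> Prop) (K : Type) :
  P K -> least_card P (min_card P).
Proof.
move=> /least_card_ex PK; rewrite /min_card.
by case: pselect => // h; exact: svalP (cid h).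
Qed.

(* [K = K1] is written instead of membership in [set K1; K2; K3], which would
   force the universe of the cardinals below that of the types carrying sets. *)
Definition min3_card (K1 K2 K3 : Type) : Type :=
  min_card (fun K => [\/ K = K1, K = K2 | K = K3]).

Definition min_size (T : Type) (Q : set T -> Prop) : Type :=
  min_card (fun K => exists2 A : set T, Q A & A #= [set: K]).

(* Unlike the library's [zero_dimensional] (distinct points are separated by a
   clopen set), which is weaker for metrizable spaces, this asks for a base of
   clopen sets. *)
Definition clopen_base (X : topologicalType) : Prop :=
  forall (x : X) (A : set X), nbhs x A ->
    exists V : set X, [/\ clopen V, V x & V `<=` A].

Definition separable_space (X : topologicalType) : Prop :=
  exists2 D : set X, countable D & dense D.

Definition metrizable (R : realType) (X : topologicalType) : Prop :=
  exists d : X -> X -> R,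
    [/\ forall x y, d x y = 0 <-> x = y,
        forall x y, d x y = d y x,
        forall x y z, d x z <= d x y + d y z
      & forall (x : X) (A : set X),
          nbhs x A <-> exists2 e : R, 0 < e & [set y | d x y < e] `<=` A].

Definition set_of_reals (R : realType) (X : topologicalType) : Prop :=
  [/\ infinite_set [set: X], clopen_base X, separable_space X
    & metrizable R X].

Definition non (R : realType) (P : topologicalType -> Prop) : Type :=
  min_card (fun K => exists X : topologicalType,
    [/\ set_of_reals R X, ~ P X & [set: X] #= [set: K]]).

Section Covers.
Variable X : Type.
Implicit Types (U : set (set X)) (AA BB : set (set (set X))).

Definition is_cover U : Prop :=
  ~ U [set: X] /\ \bigcup_(A in U) A = [set: X].

Definition large_cover U : Prop :=
  is_cover U /\ forall x, infinite_set [set A | U A /\ A x].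

Definition tau_cover U : Prop :=
  large_cover U /\
  forall x y, finite_set [set A | [/\ U A, A x & ~ A y]] \/
              finite_set [set A | [/\ U A, A y & ~ A x]].

Definition countable_tau_covers (C : set (set X)) : set (set (set X)) :=
  [set U | [/\ countable U, U `<=` C & tau_cover U]].

Definition S02 AA BB : Prop :=
  forall U : nat -> set (set X), (forall n, AA (U n)) ->
  exists F : nat -> set (set X),
    (forall n, F n `<=` U n /\ exists2 k : nat, (k < 2)%N & F n #= `I_k) /\
    BB (\bigcup_n F n).

End Covers.

Definition borel (X : topologicalType) : set (set X) := <<s @open X >>.

Definition borel_fun (X Y : topologicalType) (f : X -> Y) : Prop :=
  forall B : set Y, borel B -> borel (f @^-1` B).

Definition OT (X : topologicalType) := countable_tau_covers (@open X).
Definition CT (X : topologicalType) := countable_tau_covers (@clopen X).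
Definition BT (X : topologicalType) := countable_tau_covers (@borel X).
Arguments OT X : clear implicits.
Arguments CT X : clear implicits.
Arguments BT X : clear implicits.


Notation cantor2 := {ptws nat * nat -> bool}.

(* Below, [\forall n \near \oo] is "for all but finitely many n", and
   [A (n, m) <= B (n, m)] compares bits through the coercion to [nat]. *)
Definition tau_family (A : set cantor2) : Prop :=
  (forall a, A a -> forall n : nat,
     infinite_set [set m : nat | a (n, m) = true]) /\
  (forall a b, A a -> A b -> forall n : nat,
     (\forall m \near \oo, (a (n, m) <= b (n, m))%N) \/
     (\forall m \near \oo, (b (n, m) <= a (n, m))%N)).

(* A partial function is a map to [option nat]; [n] is in its domain when
   [g n = Some m] for some [m]. *)
Definition semi_tau_diagonalizable (A : set cantor2) : Prop :=
  exists g : nat -> option nat,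
    (forall a, A a ->
       infinite_set [set n | exists2 m, g n = Some m & a (n, m) = true]) /\
    (forall a b, A a -> A b ->
       (\forall n \near \oo,
          forall m, g n = Some m -> (a (n, m) <= b (n, m))%N) \/
       (\forall n \near \oo,
          forall m, g n = Some m -> (b (n, m) <= a (n, m))%N)).

Definition splitting_family (S : set (set nat)) : Prop :=
  (forall A, S A -> infinite_set A) /\
  (forall B : set nat, infinite_set B ->
     exists A, [/\ S A, infinite_set (B `&` A) & infinite_set (B `\` A)]).

Definition splitting_number : Type := min_size splitting_family.

Definition unbounded_family (F : set (nat -> nat)) : Prop :=
  ~ exists g : nat -> nat,
      forall f, F f -> \forall n \near \oo, (f n <= g n)%N.

Definition bounding_number : Type := min_size unbounded_family.

Definition od_number : Type :=
  min_size (fun A : set cantor2 => tau_family A /\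
    ~ exists g : nat -> nat, forall a, A a -> exists n, a (n, g n) = true).

(* Main.v *)
Require Import Defs.
From mathcomp Require Import all_boot all_order all_algebra.
From mathcomp Require Import all_classical all_reals all_analysis.
Local Open Scope classical_set_scope.
Local Open Scope card_scope.

(** Everything rests on reading a sequence of covers as a map into the Cantor
    space: [Psi x (n, m)] says whether [x] lies in the [m]-th member of the
    [n]-th cover. The covers are tau-covers exactly when the range of [Psi] is
    a tau-family, up to one difficulty: a family of indices is not a family of
    sets. Distinct indices may name the same set, so that infinitely many
    indices need not give infinitely many sets, and some may name the whole
    space.

    From diagonalizations to selections ([S02_of_diag]) this is cured by
    numbering all the sets of all the covers injectively and letting the [n]-th
    row see only the sets with a number at least [n]: every set can then be
    selected finitely often only. From selections to diagonalizations
    ([diag_of_S02]) the sets are made pairwise distinct, and distinct from the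
    whole space, first. An infinite set of reals contains infinitely many
    disjoint nonempty clopen sets, and a set may be altered on finitely many of
    them; assigning to every pair of indices its own clopen set leaves room to
    make any two sets differ, while every point changes its membership for one
    index at most ([disjointify]). Both directions work for any class of sets closed under the finite Boolean
    operations and containing the clopen sets, hence for Borel sets with Borel
    maps and for clopen sets with continuous maps.

    A tau-family [A] smaller than s, b and od is semi tau-diagonalizable
    ([small_tau_family_diag]). For each pair [a], [b] of members the rows [n]
    at which [a] is almost below [b] form a set of naturals; since there are
    fewer than s of them, an infinite set [D] of rows decides all of them up to
    finitely many rows. On [D] the column from which the comparison of [a] and
    [b] holds is a function of the row; since there are fewer than b of them,
    one function [h] dominates all. After cutting off the columns before [h] it
    is enough to meet every member of [A] infinitely often, which the
    definition of od gives by splitting [D] into infinitely many infinite sets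
    of rows. This uses families indexed by pairs, hence that an infinite set
    has the cardinality of its square ([card_square]).

    Finally, a tau-family that is not semi tau-diagonalizable is infinite, so
    that as a subspace of the Cantor space it is a set of reals, and by the
    clopen case applied to its inclusion it fails the clopen selection
    property ([witness_space]). Conversely, a set of reals that fails the Borel
    property maps onto such a family. So the three selection properties have
    the same critical cardinality, and it is bounded below by the least size
    of such a family. *)

Set Implicit Arguments.
Unset Strict Implicit.
Unset Printing Implicit Defensive.

Import Order.TTheory GRing.Theory Num.Theory.

(** * Cofinite conditions and cardinals *)

Lemma near_natP (P : nat -> Prop) :
  (\forall n \near \oo, P n) <-> exists N, forall n, (N <= n)%N -> P n.
Proof.
by split=> [[N _ NP]|[N NP]]; exists N => // n /= /NP.
Qed.

Lemma near_cofinite (P : nat -> Prop) :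
  (\forall n \near \oo, P n) <-> finite_set [set n | ~ P n].
Proof.
rewrite near_natP; split=> [[N NP]|/finite_seqP[s es]].
  apply: (@sub_finite_set _ _ `I_N) => [n /= nP|]; last exact: finite_II.
  by rewrite ltnNge; apply/negP => /NP.
exists (\sum_(i <- s) i).+1 => n ltn; apply: contrapT => nP.
have : [set n | ~ P n] n by [].
rewrite es /= => ns; move: ltn.
by rewrite (big_rem n)//= ltnNge leq_addr.
Qed.

Lemma infinite_natP (A : set nat) :
  infinite_set A <-> forall N, exists2 n, (N <= n)%N & A n.
Proof.
have -> : A = [set n | ~ ~ A n] by apply/seteqP; split => n /=; rewrite notK.
split=> [Ainf N|H /near_cofinite/near_natP[N NP]]; last first.
  by have [n /NP nA /(_ nA)] := H N.
apply: contra_notP Ainf => nex; apply/near_cofinite/near_natP; exists N => n Nn.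
by move=> nA; apply: nex; exists n => //=.
Qed.

Lemma inj_card_leP (T U : Type) (A : set T) (B : set U) (f : T -> U) :
  (forall x, A x -> B (f x)) ->
  (forall x y, A x -> A y -> f x = f y -> x = y) -> A #<= B.
Proof.
move=> fB finj.
have fe : f @` A #= A.
  by apply: inj_card_eq => x y; rewrite !inE; exact: finj.
by rewrite -(card_le_eql fe); apply: subset_card_le => _ [x Ax <-]; exact: fB.
Qed.

(** The default value [u0] is taken outside [A]. *)
Lemma card_le_inj (T U : Type) (u0 : U) (A : set T) (B : set U) : A #<= B ->
  exists f : T -> U, (forall x, A x -> B (f x)) /\
    (forall x y, A x -> A y -> f x = f y -> x = y).
Proof.
move=> /card_leP[f].
exists (fun x => if pselect (A x) is left h then val (f (SigSub (mem_set h)))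
                 else u0).
split=> [x Ax|x y Ax Ay].
  by case: pselect => // h; exact: set_valP.
case: pselect => // hx; case: pselect => // hy /val_inj.
by move=> /('inj_f) -/(_ (mem_set I) (mem_set I))[].
Qed.

Lemma leq_boolP (b c : bool) : (b <= c)%N <-> (b = true -> c = true).
Proof. by case: b; case: c; split=> //; apply. Qed.

Lemma inj_infinite (T U : Type) (A : set T) (B : set U) (f : T -> U) :
  (forall x, A x -> B (f x)) ->
  (forall x y, A x -> A y -> f x = f y -> x = y) ->
  infinite_set A -> infinite_set B.
Proof.
move=> fB finj /infiniteP Ainf; apply/infiniteP; apply: (card_le_trans Ainf).
exact: inj_card_leP fB finj.
Qed.

Lemma finite_leq (A : set nat) N :
  (forall n, (N <= n)%N -> ~ A n) -> finite_set A.
Proof.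
move=> NA; apply: (@sub_finite_set _ _ `I_N); last exact: finite_II.
by move=> n An /=; rewrite ltnNge; apply/negP => /NA.
Qed.

(** The selections of the covering property are thus the partial functions that
    pick one set from a cover. *)
Lemma card_lt2P (T : Type) (A : set T) :
  (exists2 k : nat, (k < 2)%N & A #= `I_k) <->
  (forall x y, A x -> A y -> x = y).
Proof.
split=> [[k k2 Ak] x y Ax Ay|A1].
  have : A #<= `I_k by rewrite -(card_le_eqr Ak) card_lexx.
  move=> /(card_le_inj 0%N)[f [fk finj]]; apply: finj => //.
  have /= := fk _ Ax; have /= := fk _ Ay.
  by case: k k2 {Ak fk} => [|[|//]] // _; rewrite !ltnS !leqn0 => /eqP-> /eqP->.
have [[x Ax]|/set0P/negP] := pselect (A !=set0).
  exists 1%N => //; rewrite (_ : A = [set x]); first exact: card_set1.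
  by apply/seteqP; split=> [y Ay|_ ->//]; exact: A1.
by rewrite negbK => /eqP->; exists 0%N => //; rewrite II0 card_eq00.
Qed.

Lemma min_card_le (P : Type -> Prop) (K : Type) :
  P K -> [set: min_card P] #<= [set: K].
Proof. by move=> PK; have [_] := min_cardP PK; apply. Qed.

(** The minimum over an empty class is the empty type, so it is below anything;
    this settles the cases in which a cardinal number has no witness. *)
Lemma min_card_empty (P : Type -> Prop) (L : Type) (B : set L) :
  (forall K, ~ P K) -> [set: min_card P] #<= B.
Proof.
move=> nP; rewrite /min_card; case: pselect => [h|_].
  by have [K [/nP]] := h.
by rewrite (_ : [set: False] = set0) ?card_ge0//; apply/seteqP; split=> -[].
Qed.

Lemma min_size_le (T : Type) (Q : set T -> Prop) (A : set T) :
  Q A -> [set: min_size Q] #<= A.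
Proof.
move=> QA; rewrite -(card_le_eqr (card_setT A)); apply: min_card_le.
by exists A => //; exact: card_setT_sym.
Qed.

Lemma min3_card_le (K1 K2 K3 K L : Type) (B : set L) :
  [\/ K = K1, K = K2 | K = K3] -> [set: K] #<= B ->
  [set: min3_card K1 K2 K3] #<= B.
Proof.
move=> HK; apply: card_le_trans.
exact: (@min_card_le (fun K => [\/ K = K1, K = K2 | K = K3])).
Qed.

Lemma min_size_attained (T : Type) (Q : set T -> Prop) (A : set T) :
  Q A -> exists2 B, Q B & B #= [set: min_size Q].
Proof.
move=> QA; pose P K := exists2 B : set T, Q B & B #= [set: K].
have PA : P A by exists A => //; exact: card_setT_sym.
by have [] := min_cardP PA.
Qed.

Lemma non_attained (R : realType) (P : topologicalType -> Prop)
    (X : topologicalType) : set_of_reals R X -> ~ P X ->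
  exists Y : topologicalType,
    [/\ set_of_reals R Y, ~ P Y & [set: Y] #= [set: non R P]].
Proof.
move=> XR nP; pose Q K := exists Y : topologicalType,
  [/\ set_of_reals R Y, ~ P Y & [set: Y] #= [set: K]].
have QX : Q X by exists X; split=> //; exact: card_eqxx.
by have [] := min_cardP QX.
Qed.

(** The hypotheses are needed in both directions even for one inequality:
    if no space fails one of the properties, the other one must not fail
    either, since the minimum is then the default value. *)
Lemma non_eq (R : realType) (P Q : topologicalType -> Prop) :
  (forall X, set_of_reals R X -> ~ P X -> exists Y : topologicalType,
     [/\ set_of_reals R Y, ~ Q Y & [set: Y] #<= [set: X]]) ->
  (forall X, set_of_reals R X -> ~ Q X -> exists Y : topologicalType,
     [/\ set_of_reals R Y, ~ P Y & [set: Y] #<= [set: X]]) ->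
  [set: non R P] #= [set: non R Q].
Proof.
have half (P' Q' : topologicalType -> Prop) :
  (forall X, set_of_reals R X -> ~ P' X -> exists Y : topologicalType,
     [/\ set_of_reals R Y, ~ Q' Y & [set: Y] #<= [set: X]]) ->
  (forall X, set_of_reals R X -> ~ Q' X -> exists Y : topologicalType,
     [/\ set_of_reals R Y, ~ P' Y & [set: Y] #<= [set: X]]) ->
  [set: non R Q'] #<= [set: non R P'].
  move=> PQ QP.
  have [[X [XR nP]]|nX] :=
      pselect (exists X : topologicalType, set_of_reals R X /\ ~ P' X).
    have [Z [ZR nPZ ZE]] := non_attained XR nP.
    rewrite -(card_le_eqr ZE); have [Y [YR nQ YZ]] := PQ Z ZR nPZ.
    apply: card_le_trans YZ; apply: min_card_le.
    by exists Y; split=> //; exact: card_eqxx.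
  apply: min_card_empty => K [Y [YR /(QP Y YR)[X [XR nP _]] _]].
  by apply: nX; exists X.
by move=> PQ QP; rewrite card_eq_le; apply/andP; split; exact: half.
Qed.

(** * The square of an infinite set *)

Section Square.
Variables (T : Type).
Implicit Types (G : set ((T * T) * T)) (S A : set T).

(** Injections of a square [S `*` S] in [S] are represented by their graphs, so
    that the union of a chain of them is again one; the set [S] is recovered as
    the set of the points whose diagonal pair has an image. *)
Definition square_field G : set T := [set x | exists z, G ((x, x), z)].

Definition square_inj A G :=
  [/\ forall p z z', G (p, z) -> G (p, z') -> z = z',
      forall p p' z, G (p, z) -> G (p', z) -> p = p',
      forall x y, square_field G x -> square_field G y ->
        exists z, G ((x, y), z),
      forall x y z, G ((x, y), z) ->
        [/\ square_field G x, square_field G y & square_field G z]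
    & forall x, square_field G x -> A x].

Lemma square_field_sub {G} G' {x} : G `<=` G' ->
  square_field G x -> square_field G' x.
Proof. by move=> GG' [z Gz]; exists z; exact: GG'. Qed.

(** Keeping a fixed [G0] in the union makes the empty chain harmless, and makes
    every maximal element extend [G0]. *)
Lemma square_inj_chain A G0 (C : set (set ((T * T) * T))) :
  square_inj A G0 -> (forall G, C G -> square_inj A (G0 `|` G)) ->
  total_on C subset -> square_inj A (G0 `|` \bigcup_(G in C) G).
Proof.
move=> G0A CA Ctot; set M := _ `|` _.
(* Each condition concerns two triples at most, which lie in one member. *)
have two p q : M p -> M q ->
    exists G, [/\ square_inj A G, G `<=` M, G p & G q].
  have inM G : C G -> G0 `|` G `<=` M.
    by move=> CG r [?|?]; [left|right; exists G].
  move=> [p0|[G CG Gp]] [q0|[G' CG' Gq]].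
  - by exists G0; split => // r ?; left.
  - by exists (G0 `|` G'); split; [exact: CA|exact: inM|left|right].
  - by exists (G0 `|` G); split; [exact: CA|exact: inM|right|left].
  - have [GG'|GG'] := Ctot _ _ CG CG'.
      exists (G0 `|` G'); split; [exact: CA|exact: inM| |by right].
      by right; exact: GG'.
    exists (G0 `|` G); split; [exact: CA|exact: inM|by right|].
    by right; exact: GG'.
split.
- by move=> p z z' /two + /[dup] + _ => /[apply] -[G [[+ _ _ _ _] _]]; exact.
- by move=> p p' z /two + /[dup] + _ => /[apply] -[G [[_ + _ _ _] _]]; exact.
- move=> x y [z Mx] [z' My]; have [G [[_ _ + _ _] GM Gx Gy]] := two _ _ Mx My.
  move=> /(_ x y (ex_intro _ _ Gx) (ex_intro _ _ Gy))[t Gt].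
  by exists t; exact: GM.
- move=> x y z Mz; have [G [[_ _ _ + _] GM Gz _]] := two _ _ Mz Mz.
  by move=> /(_ _ _ _ Gz)[? ? ?]; split; exact: square_field_sub GM _.
- move=> x [z Mx]; have [G [[_ _ _ _ +] GM Gx _]] := two _ _ Mx Mx.
  by apply; exists z.
Qed.

Lemma square_inj_fun A G : square_inj A G ->
  exists f : T * T -> T,
    forall x y, square_field G x -> square_field G y -> G ((x, y), f (x, y)).
Proof.
move=> [_ _ tot _ _].
have H p : exists z, square_field G p.1 -> square_field G p.2 -> G (p, z).
  have [[p1 p2]|] := pselect (square_field G p.1 /\ square_field G p.2).
    have [z] := tot _ _ p1 p2; rewrite -surjective_pairing => Gz.
    by exists z.
  by move=> np; exists p.1 => p1 p2; case: np.
by have [f fP] := choice H; exists f => x y ? ?; exact: fP.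
Qed.

(** A starting point for Zorn's lemma with infinite field: without it the
    maximal element could be the injection of the square of a singleton. *)
Lemma card_square_nat A : infinite_set A ->
  exists2 G0, square_inj A G0 & infinite_set (square_field G0).
Proof.
move=> Ainf.
have [t0 _] := infinite_setN0 Ainf.
have /infiniteP/(card_le_inj t0)[u [uA uinj]] := Ainf.
pose c (p : nat * nat) : nat := pickle p.
have cinj p q : c p = c q -> p = q by move/(pcan_inj pickleK).
pose G0 : set ((T * T) * T) := [set r | exists i j, r = ((u i, u j), u (c (i, j)))].
have f0 x : square_field G0 x <-> exists i, x = u i.
  split=> [[z [i [j [-> _ _]]]]|[i ->]]; first by exists i.
  by exists (u (c (i, i))), i, i.
have ui i j : u i = u j -> i = j by exact: uinj.
exists G0; first split.
- move=> _ z z' [i [j [-> ->]]] [i' [j' [/ui -> /ui -> ->]]] //.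
- move=> p p' _ [i [j [-> ->]]] [i' [j' [-> /ui/cinj[-> ->]]]] //.
- move=> x y /f0[i ->] /f0[j ->]; exists (u (c (i, j))); by exists i, j.
- move=> x y z [i [j [-> -> ->]]].
  by split; apply/f0; [exists i|exists j|exists (c (i, j))].
- by move=> x /f0[i ->]; exact: uA.
apply/infiniteP; apply: (@inj_card_leP _ _ _ _ u) => [i _|i j _ _ /ui//].
by apply/f0; exists i.
Qed.

(** Let [S] be the field of a maximal injection of a square in its side. If the
    rest of [A] is no larger than [S], then [A] embeds in two copies of [S],
    hence in [S], and its square in the square of [S]. Otherwise a copy of [S]
    fits in the rest of [A], and the new part of the square of the enlarged
    field can be mapped into this copy, against maximality. *)
Lemma card_square A : infinite_set A -> A `*` A #<= A.
Proof.
move=> Ainf; have [G0 G0A S0inf] := card_square_nat Ainf.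
pose P G := square_inj A (G0 `|` G).
have [C CP Ctot|G1 [PG1 maxG1]] := @Zorn_bigcup _ P.
  exact: square_inj_chain.
pose G := G0 `|` G1; pose S := square_field G.
have GA : square_inj A G := PG1.
have [f fG] := square_inj_fun GA.
case: (GA) => Gfun Ginj Gtot Gfld GSA.
have Sinf : infinite_set S.
  by apply: sub_infinite_set S0inf => x; apply: square_field_sub => ? ?; left.
have fS x y : S x -> S y -> S (f (x, y)).
  by move=> Sx Sy; have [] := Gfld _ _ _ (fG _ _ Sx Sy).
have finj x y x' y' : S x -> S y -> S x' -> S y' ->
    f (x, y) = f (x', y') -> x = x' /\ y = y'.
  move=> Sx Sy Sx' Sy' e.
  have := fG _ _ Sx' Sy'; rewrite -e => Gf.
  by have [-> ->] := Ginj _ _ _ (fG _ _ Sx Sy) Gf.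
have [s0 Ss0] := infinite_setN0 Sinf.
have [s1 [Ss1 s01]] : exists s1, S s1 /\ s1 <> s0.
  apply: contra_notP Sinf => H; apply: (@sub_finite_set _ _ [set s0]) => //.
  by move=> x Sx; apply: contrapT => xs0; apply: H; exists x.
have SS : S `*` S #<= S.
  apply: (@inj_card_leP _ _ _ _ f) => [[x y] [/= Sx Sy]|]; first exact: fS.
  move=> [x y] [x' y'] [/= Sx Sy] [/= Sx' Sy'] e.
  by have [-> ->] := finj _ _ _ _ Sx Sy Sx' Sy' e.
have [AS|SA] : A `\` S #<= S \/ S #<= A `\` S.
  have [H|H] := card_le_total (A `\` S : set T) (S : set T); [left|right];
    by move: H; rewrite (card_le_eql (card_setT _)) (card_le_eqr (card_setT _)).
- have [h [hS hinj]] := card_le_inj s0 AS.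
  have AleS : A #<= S.
    apply: (@inj_card_leP _ _ _ _
      (fun x => if pselect (S x) then f (s0, x) else f (s1, h x))).
      by move=> x Ax; case: pselect => Sx; apply: fS => //; apply: hS.
    move=> x y Ax Ay; case: pselect => Sx; case: pselect => Sy e.
    + by have [] := finj _ _ _ _ Ss0 Sx Ss0 Sy e.
    + by have [/esym//] := finj _ _ _ _ Ss0 Sx Ss1 (hS _ (conj Ay Sy)) e.
    + by have [//] := finj _ _ _ _ Ss1 (hS _ (conj Ax Sx)) Ss0 Sy e.
    + have [_] := finj _ _ _ _ Ss1 (hS _ (conj Ax Sx)) Ss1 (hS _ (conj Ay Sy)) e.
      by apply: hinj.
  have [g [gS ginj]] := card_le_inj s0 AleS.
  apply: (card_le_trans (B := S `*` S)).
    apply: (@inj_card_leP _ _ _ _ (fun p => (g p.1, g p.2))).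
      by move=> [x y] [/= Ax Ay]; split => /=; exact: gS.
    move=> [x y] [x' y'] [/= Ax Ay] [/= Ax' Ay'] [e1 e2].
    by rewrite (ginj _ _ Ax Ax' e1) (ginj _ _ Ay Ay' e2).
  by apply: (card_le_trans SS); apply: subset_card_le => x; exact: GSA.
- exfalso; have [h [hA hinj]] := card_le_inj s0 SA.
  pose S' := S `|` h @` S.
  (* Two disjoint copies of [S] fit in [S], marked by [s0] and [s1]. *)
  have [r [rS rinj]] : exists r : T -> T, (forall x, S' x -> S (r x)) /\
      (forall x y, S' x -> S' y -> r x = r y -> x = y).
    have H x : exists z, S' x -> (S x /\ z = f (s0, x)) \/
        (exists u, [/\ S u, x = h u & z = f (s1, u)]).
      have [Sx|nSx] := pselect (S x); first by exists (f (s0, x)); left.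
      have [[u Su hu]|nu] := pselect ((h @` S) x).
        by exists (f (s1, u)) => _; right; exists u.
      by exists x => -[].
    have [r rP] := choice H; exists r; split.
      by move=> x /rP[[Sx ->]|[u [Su _ ->]]]; exact: fS.
    move=> x y /rP[[Sx ->]|[u [Su -> ->]]] /rP[[Sy ->]|[v [Sv -> ->]]] e.
    + by have [] := finj _ _ _ _ Ss0 Sx Ss0 Sy e.
    + by have [/esym//] := finj _ _ _ _ Ss0 Sx Ss1 Sv e.
    + by have [//] := finj _ _ _ _ Ss1 Su Ss0 Sy e.
    + by have [_ ->] := finj _ _ _ _ Ss1 Su Ss1 Sv e.
  (* The new pairs must go to the new points, as [S] may be used up. *)
  pose e (p : T * T) := h (f (r p.1, r p.2)).
  pose N : set ((T * T) * T) := [set q | [/\ S' q.1.1, S' q.1.2,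
     ~ (S q.1.1 /\ S q.1.2) & q.2 = e q.1]].
  have eS x y : S' x -> S' y -> (h @` S) (e (x, y)).
    by move=> Sx Sy; exists (f (r x, r y)) => //; apply: fS; exact: rS.
  have hNS x : (h @` S) x -> ~ S x by move=> [u Su <-]; case: (hA _ Su).
  have fld x : square_field (G `|` N) x <-> S' x.
    split=> [[z [Gz|[]//]]|S'x].
      by left; have [] := Gfld _ _ _ Gz.
    have [Sx|nSx] := pselect (S x).
      by exists (f (x, x)); left; exact: fG.
    by exists (e (x, x)); right; split => // -[].
  have GN p z : G (p, z) -> [/\ S p.1, S p.2 & S z].
    by case: p => x y /Gfld.
  have PG : P (G `|` N).
    rewrite /P (_ : _ `|` _ = G `|` N); last by rewrite setUA /G setUA setUid.
    split.
    + move=> p z z' [Gz|[/= p1 p2 np ->]] [Gz'|[/= p1' p2' np' ->]] //.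
      * exact: Gfun Gz Gz'.
      * by case: np'; have [] := GN _ _ Gz.
      * by case: np; have [] := GN _ _ Gz'.
    + move=> [x y] [x' y'] z [Gz|[/= p1 p2 np ez]] [Gz'|[/= p1' p2' np' ez']].
      * exact: Ginj Gz Gz'.
      * have [_ _ Sz] := GN _ _ Gz.
        by case: (hNS _ (eS _ _ p1' p2')); rewrite -ez'.
      * have [_ _ Sz] := GN _ _ Gz'.
        by case: (hNS _ (eS _ _ p1 p2)); rewrite -ez.
      * have Sr1 := rS _ p1; have Sr2 := rS _ p2.
        have Sr1' := rS _ p1'; have Sr2' := rS _ p2'.
        have := etrans (esym ez) ez'.
        move=> /(hinj _ _ (fS _ _ Sr1 Sr2) (fS _ _ Sr1' Sr2')).
        move=> /(finj _ _ _ _ Sr1 Sr2 Sr1' Sr2')[].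
        by move=> /(rinj _ _ p1 p1')-> /(rinj _ _ p2 p2')->.
    + move=> x y /fld S'x /fld S'y.
      have [[Sx Sy]|nS] := pselect (S x /\ S y).
        by exists (f (x, y)); left; exact: fG.
      by exists (e (x, y)); right.
    + move=> x y z [/GN[/= Sx Sy Sz]|[/= S'x S'y _ ->]].
        by split; apply/fld; left.
      by split; apply/fld => //; right; exact: eS.
    + move=> x /fld[/GSA//|[u Su <-]]; by case: (hA _ Su).
  apply: (maxG1 (G `|` N)) PG; split=> [p ?|/(_ ((h s0, h s0), e (h s0, h s0)))].
    by left; right.
  have hs0 : (h @` S) (h s0) by exists s0.
  have /[swap]/[apply] : (G `|` N) ((h s0, h s0), e (h s0, h s0)).
    right; split => /=; [by right|by right|by move=> [/(hNS _ hs0)]|by []].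
  move=> G1h; have : G ((h s0, h s0), e (h s0, h s0)) by right.
  by move=> /GN[/(hNS _ hs0)].
Qed.
End Square.

(** * Small tau-families *)

Section SmallFamilies.
Variables (T : Type) (I : set T).

(** Only the infinite members of the family can belong to a splitting family;
    the finite ones are decided by any infinite set. *)
Lemma exists_undivided (F : T -> set nat) : ~ ([set: splitting_number] #<= I) ->
  exists2 D, infinite_set D & forall i, I i ->
    finite_set (D `&` F i) \/ finite_set (D `\` F i).
Proof.
move=> sI; apply: contrapT => nD; apply: sI.
pose S : set (set nat) := [set X | infinite_set X /\ (F @` I) X].
apply: (@card_le_trans _ _ _ S).
  apply: min_size_le; split=> [X []//|B Binf].
  apply: contrapT => nS; apply: nD; exists B => // i Ii.
  apply: contrapT => /not_orP[BF BnF]; apply: nS; exists (F i); split => //.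
  split; last by exists i.
  by apply: sub_infinite_set BF => ? [].
apply: (card_le_trans _ (card_image_le F I)).
by apply: subset_card_le => X [].
Qed.

Lemma exists_dominating (f : T -> nat -> nat) : ~ ([set: bounding_number] #<= I) ->
  exists h : nat -> nat, forall i, I i -> \forall n \near \oo, (f i n <= h n)%N.
Proof.
move=> bI; apply: contrapT => nh; apply: bI.
apply: (card_le_trans _ (card_image_le f I)).
apply: min_size_le => -[h hP]; apply: nh; exists h => i Ii.
by apply: hP; exists i.
Qed.

Lemma exists_o_diagonal (F : T -> cantor2) : ~ ([set: od_number] #<= I) ->
  tau_family (F @` I) ->
  exists g : nat -> nat, forall i, I i -> exists n, F i (n, g n) = true.
Proof.
move=> oI tF; apply: contrapT => ng; apply: oI.
apply: (card_le_trans _ (card_image_le F I)).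
apply: min_size_le; split => // -[g gP]; apply: ng; exists g => i Ii.
by apply: gP; exists i.
Qed.

End SmallFamilies.

(** The pairs serve to cut [D] into infinitely many infinite pieces. *)
Lemma infinite_enum (D : set nat) : infinite_set D ->
  exists e : nat * nat -> nat, (forall p, D (e p)) /\ injective e.
Proof.
move=> /infiniteP; rewrite -(card_le_eql card_nat2) => /(card_le_inj 0%N).
by move=> [e [eD einj]]; exists e; split=> [p|p q]; [exact: eD|exact: einj].
Qed.

Lemma tau_family_finite_min (A : set cantor2) n (s : seq cantor2) :
  tau_family A -> A !=set0 -> (forall b, b \in s -> A b) ->
  exists2 a, A a &
    \forall m \near \oo, forall b, b \in s -> (a (n, m) <= b (n, m))%N.
Proof.
move=> [_ Atot] [a0 Aa0]; elim: s => [|x s IH] sA.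
  by exists a0 => //; apply: nearW.
have [b bs|a Aa amin] := IH; first by apply: sA; rewrite inE bs orbT.
have Ax : A x by apply: sA; rewrite inE eqxx.
have [ax|xa] := Atot _ _ Aa Ax n.
  exists a => //; apply: filterS2 ax amin => m ax amin b.
  by rewrite inE => /predU1P[->//|]; exact: amin.
exists x => //; apply: filterS2 xa amin => m xa amin b.
rewrite inE => /predU1P[->//|bs]; exact: leq_trans xa (amin _ bs).
Qed.

(** In each row a finite family has a member that is almost below all others,
    so some column of the row is met by all members at once. *)
Lemma finite_tau_family_diag (A : set cantor2) :
  finite_set A -> tau_family A -> semi_tau_diagonalizable A.
Proof.
move=> /finite_seqP[s As] tA.
have [A0|/set0P/negP] := pselect (A !=set0); last first.
  rewrite negbK => /eqP ->; exists (fun=> None).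
  by split=> [?|? ?] [].
have H n : exists m, forall b, A b -> b (n, m) = true.
  have [|a Aa /near_natP[N aN]] := tau_family_finite_min n (s := s) tA A0.
    by move=> b; rewrite As.
  have [/(_ _ Aa n)/infinite_natP/(_ N)[m Nm am] _] := tA.
  exists m => b; rewrite As => /(aN _ Nm); rewrite am.
  by case: (b (n, m)).
have [g gP] := choice H; exists (fun n => Some (g n)); split.
  move=> a Aa; rewrite (_ : mkset _ = [set: nat]); first exact: infinite_nat.
  by apply/seteqP; split=> // n _; exists (g n) => //; exact: gP.
move=> a b Aa Ab; left; apply: nearW => n m [<-].
by rewrite !gP.
Qed.

Lemma small_tau_family_diag (A : set cantor2) :
  tau_family A ->
  ~ ([set: min3_card splitting_number bounding_number od_number] #<= A) ->
  semi_tau_diagonalizable A.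
Proof.
move=> tA Asmall.
have [Ainf|Afin] := pselect (infinite_set A); last first.
  by apply: finite_tau_family_diag tA; apply: contrapT.
have AA : A `*` A #<= A := card_square Ainf.
have small K : [\/ K = splitting_number, K = bounding_number | K = od_number] ->
    ~ ([set: K] #<= A) by move=> HK /(min3_card_le HK).
have sA : ~ ([set: splitting_number] #<= A) by apply: small; constructor 1.
have bA : ~ ([set: bounding_number] #<= A) by apply: small; constructor 2.
have oA : ~ ([set: od_number] #<= A) by apply: small; constructor 3.
pose le n (p : cantor2 * cantor2) :=
  \forall m \near \oo, (p.1 (n, m) <= p.2 (n, m))%N.
have [|D Dinf DP] := @exists_undivided _ (A `*` A) (fun p => [set n | le n p]).
  by move/card_le_trans => /(_ _ _ AA).
have : exists f : cantor2 * cantor2 -> nat -> nat, forall p n, le n p ->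
    forall m, (f p n <= m)%N -> (p.1 (n, m) <= p.2 (n, m))%N.
  have H (pn : (cantor2 * cantor2) * nat) : exists N, le pn.2 pn.1 ->
      forall m, (N <= m)%N -> (pn.1.1 (pn.2, m) <= pn.1.2 (pn.2, m))%N.
    have [/near_natP[N]|nle] := pselect (le pn.2 pn.1); first by exists N.
    by exists 0%N.
  have [f fP] := choice H; exists (fun p n => f (p, n)) => p n.
  exact: (fP (p, n)).
move=> [f fP].
have [|h hP] := @exists_dominating _ (A `*` A) f.
  by move/card_le_trans => /(_ _ _ AA).
(* Beyond [h] on [D] the comparison has no exceptions within a row. *)
pose lt (a b : cantor2) := \forall n \near \oo, D n ->
  forall m, (h n <= m)%N -> (a (n, m) <= b (n, m))%N.
have half a b : A a -> A b -> finite_set (D `\` [set n | le n (a, b)]) -> lt a b.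
  move=> Aa Ab fin; have {}fin : \forall n \near \oo, D n -> le n (a, b).
    apply/near_cofinite; apply: sub_finite_set fin => n /= /not_implyP[Dn nle].
    by split.
  apply: filterS2 fin (hP (a, b) (conj Aa Ab)) => n Dle fh /Dle len m hm.
  by apply: fP len _ _; exact: leq_trans hm.
have ltW a b : A a -> A b -> lt a b \/ lt b a.
  move=> Aa Ab; have [fin|fin] := DP (a, b) (conj Aa Ab); last first.
    by left; exact: half.
  right; apply: half => //; apply: sub_finite_set fin => n [Dn nle]; split => //.
  by have [_ /(_ a b Aa Ab n)[]] := tA.
(* The rows [e (k, n)], for each [k], serve to meet all members once. *)
have [e [eD einj]] := infinite_enum Dinf.
have : forall k, exists G : nat -> nat, forall a, A a ->
    exists n, a (e (k, n), (G n + h (e (k, n)))%N) = true.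
  move=> k; pose F (a : cantor2) : cantor2 :=
    fun p => a (e (k, p.1), (p.2 + h (e (k, p.1)))%N).
  apply: (@exists_o_diagonal _ A F) => //; case: tA => Aroot Atot; split.
    move=> _ [a Aa <-] n; apply/infinite_natP => N.
    have /infinite_natP/(_ (N + h (e (k, n)))%N)[m Nm am] := Aroot _ Aa (e (k, n)).
    have hm : (h (e (k, n)) <= m)%N := leq_trans (leq_addl _ _) Nm.
    exists (m - h (e (k, n)))%N; last by rewrite /= /F /= subnK.
    by rewrite -(leq_add2r (h (e (k, n)))) subnK.
  have shift (a b : cantor2) n :
      (\forall m \near \oo, (a (e (k, n), m) <= b (e (k, n), m))%N) ->
      \forall m \near \oo, (F a (n, m) <= F b (n, m))%N.
    move=> /near_natP[N NP]; apply/near_natP; exists N => m Nm.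
    by apply: NP; rewrite (leq_trans Nm)// leq_addr.
  move=> _ _ [a Aa <-] [b Ab <-] n.
  by have [/shift|/shift] := Atot _ _ Aa Ab (e (k, n)); [left|right].
move=> /choice[G GP].
pose g n := if pselect (exists p, e p = n) is left H then
  let p := sval (cid H) in Some (G p.1 p.2 + h n)%N else None.
have ge p : g (e p) = Some (G p.1 p.2 + h (e p))%N.
  rewrite /g; case: pselect => [H|[]]; last by exists p.
  by case: cid => q /= /einj ->.
have gD n m : g n = Some m -> D n /\ (h n <= m)%N.
  rewrite /g; case: pselect => // H [<-]; split; last exact: leq_addl.
  by case: H => p <-.
exists g; split=> [a Aa|a b Aa Ab].
  have H k : exists n, a (e (k, n), (G k n + h (e (k, n)))%N) = true by exact: GP.
  have [u uP] := choice H; apply/infiniteP.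
  apply: (@inj_card_leP _ _ _ _ (fun k => e (k, u k))) => [k _|k k' _ _ /einj[]//].
  by exists (G k (u k) + h (e (k, u k)))%N => //; exact: ge.
by have [ab|ab] := ltW _ _ Aa Ab; [left|right]; apply: filterS ab => n abn m;
  move=> /gD[Dn hm]; exact: abn.
Qed.

(** * Selections and diagonalizations *)

Section Diagonalization.
Variables (X : Type) (C : set (set X)).

(** The sets of all covers are numbered by the injection [c], and the row of
    the [n]-th cover ignores the numbers below [n]. This keeps the row a row of
    a tau-family, since finitely many sets are lost, and it forces infinitely
    many selections to give infinitely many sets. *)
Lemma S02_of_diag (x0 : X) : C set0 ->
  (forall Psi : X -> cantor2, (forall p, C [set x | Psi x p = true]) ->
     tau_family (range Psi) -> semi_tau_diagonalizable (range Psi)) ->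
  S02 (countable_tau_covers C) (countable_tau_covers C).
Proof.
move=> C0 H U UP.
have [c cinj] : exists c : set X -> nat, forall A B n n',
    U n A -> U n' B -> c A = c B -> A = B.
  have : countable (\bigcup_n U n).
    by apply: bigcup_countable => // n _; have [] := UP n.
  move=> /(card_le_inj 0%N)[c [_ cinj]]; exists c => A B n n' UA UB.
  by apply: cinj; [exists n|exists n'].
have Uinf n x : infinite_set [set A | U n A /\ A x] by have [_ _ [[]]] := UP n.
pose Psi x : cantor2 := fun p =>
  `[< (p.1 <= p.2)%N /\ exists A, [/\ U p.1 A, A x & c A = p.2] >].
have PsiP x n m : Psi x (n, m) = true <->
    (n <= m)%N /\ exists A, [/\ U n A, A x & c A = m].
  by split=> [/asboolP//|?]; apply/asboolP.
have Psic x n A : U n A -> Psi x (n, c A) = true -> A x.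
  by move=> UA /PsiP[_ [B [UB Bx /(cinj _ _ _ _ UB UA) <-]]].
have [|//|g [ginf gtot]] := H Psi.
- move=> [n m]; have [[A [UA cA nm]]|nA] :=
      pselect (exists A, [/\ U n A, c A = m & (n <= m)%N]).
    rewrite (_ : mkset _ = A); first by have [_ + _] := UP n; apply.
    apply/seteqP; split=> x /=; first by rewrite -cA; exact: Psic.
    by move=> Ax; apply/PsiP; split => //; exists A.
  rewrite (_ : mkset _ = set0)//; apply/seteqP; split=> x //= /PsiP[nm].
  by move=> [A [UA Ax cA]]; apply: nA; exists A.
- split=> [_ [x _ <-] n|_ _ [x _ <-] [y _ <-] n].
    apply/infinite_natP => N; apply: contrapT => nex; apply: (Uinf n x).
    have cfin : finite_set (c @` [set A | U n A /\ A x]).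
      apply: (@finite_leq _ (maxn n N)) => m; rewrite geq_max => /andP[nm Nm].
      move=> [A [UA Ax] cA]; apply: nex; exists m => //.
      by apply/PsiP; split=> //; exists A.
    apply: contrapT => inf; apply: (inj_infinite (f := c) _ _ inf cfin).
      by move=> A UA; exists A.
    by move=> A B [UA _] [UB _]; exact: cinj UA UB.
  have half u v : finite_set [set A | [/\ U n A, A u & ~ A v]] ->
      \forall m \near \oo, (Psi u (n, m) <= Psi v (n, m))%N.
    move=> fin; apply/near_cofinite.
    apply: sub_finite_set (finite_image c fin) => m /= /leq_boolP.
    move=> /not_implyP[/PsiP[nm [A [UA Au cA]]] nv]; exists A => //.
    by split=> // Av; apply: nv; apply/PsiP; split => //; exists A.
  by have [_ _ [_ /(_ x y)[/half|/half]]] := UP n; [left|right].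
pose F n := [set A | [/\ U n A, (n <= c A)%N & g n = Some (c A)]].
have Ffin n : finite_set (F n).
  apply: (@sub_finite_set _ _ (F n)) => //.
  have /card_lt2P[k _ Fk] : forall A B, F n A -> F n B -> A = B.
    by move=> A B [UA _ gA] [UB _]; rewrite gA => -[]; exact: cinj UA UB.
  by apply/finite_setP; exists k.
have Finf x : infinite_set [set A | (\bigcup_n F n) A /\ A x].
  move=> /(finite_image c); apply/infinite_natP => N.
  have /infinite_natP/(_ N)[n Nn [m gn /PsiP[nm [A [UA Ax cA]]]]] :=
    ginf _ (imageT Psi x).
  exists m; first exact: leq_trans nm.
  by exists A => //; split=> //; exists n => //; split; rewrite ?cA.
exists F; split=> [n|].
  split=> [A []//|]; apply/card_lt2P => A B [UA _ gA] [UB _].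
  by rewrite gA => -[]; exact: cinj UA UB.
split.
- by apply: bigcup_countable => // n _; exact: finite_set_countable.
- by move=> A [n _ [UA _ _]]; have [_ + _] := UP n; apply.
- split; first split => //; first split.
  + by move=> [n _ [UT _ _]]; have [_ _ [[[]]]] := UP n.
  + apply/seteqP; split=> // x _.
    by have [A [[n _ FA] Ax]] := infinite_setN0 (Finf x); exists A => //; exists n.
  + have half u v : (\forall n \near \oo,
        forall m, g n = Some m -> (Psi u (n, m) <= Psi v (n, m))%N) ->
        finite_set [set A | [/\ (\bigcup_n F n) A, A u & ~ A v]].
      move=> /near_natP[N NP]; apply: (@sub_finite_set _ _ (\bigcup_(n in `I_N) F n)).
        move=> A [[n _ FA] Au nAv]; exists n => //=; rewrite ltnNge; apply/negP.
        move=> Nn; have [UA nc gA] := FA.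
        have /leq_boolP Pv := NP _ Nn _ gA; apply/nAv/(Psic _ _ _ UA).
        by apply/Pv/PsiP; split=> //; exists A.
      by apply: bigcup_finite => // n _; exact: Ffin.
    by move=> x y; have [/half|/half] := gtot _ _ (imageT Psi x) (imageT Psi y);
      [left|right].
Qed.

Variables (K : nat * nat -> set X).
Hypotheses (C0 : C set0) (CD : forall A B, C A -> C B -> C (A `\` B))
  (CU : forall A B, C A -> C B -> C (A `|` B)).
Hypotheses (CK : forall p, C (K p)) (K0 : forall p, K p !=set0)
  (Kdisj : forall p q x, K p x -> K q x -> p = q).

(** The clopen set [K (i, k)] with [i <= k] is reserved for the [k]-th set:
    outside these sets [V k] is [U k], on [K (i, k)] with [i < k] it is full
    or empty so as to differ at a chosen point from [U i], which is [V i]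
    there, and on [K (k, k)] it is empty, so that
    [V k] is not the whole space. A point lies in one [K (i, k)] at most, so
    it changes its membership for one [k] at most. *)
Lemma disjointify (U : nat -> set X) : (forall k, C (U k)) ->
  exists V : nat -> set X, [/\ forall k, C (V k), forall k, V k <> [set: X],
    injective V & forall x, exists k0, forall k, k <> k0 -> V k x <-> U k x].
Proof.
move=> CUk; have [pt ptK] := choice K0.
pose D i k := if `[< U i (pt (i, k)) >] then set0 else K (i, k).
have DP i k x : D i k x <-> ~ U i (pt (i, k)) /\ K (i, k) x.
  by rewrite /D; case: asboolP => H; split => // -[].
pose V k := (U k `\` \bigcup_(i in `I_k.+1) K (i, k)) `|`
            \bigcup_(i in `I_k) D i k.
have Cbig (G : nat -> set X) n : (forall i, C (G i)) ->
    C (\bigcup_(i in `I_n) G i).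
  move=> CG; rewrite bigcup_mkord; elim: n => [|n IH]; first by rewrite big_ord0.
  by rewrite big_ord_recr/=; exact: CU.
have Vdiag k : ~ V k (pt (k, k)).
  move=> [[_]|[i ik /DP[_ Kp]]]; first by apply; exists k => /=.
  by move: ik; have [->] := Kdisj Kp (ptK _); rewrite /= ltnn.
have Vup i k : (i < k)%N -> V k (pt (i, k)) <-> ~ U i (pt (i, k)).
  move=> ik; split=> [[[_]|[j jk /DP[nU Kp]]]|nU].
  - by case; exists i => //=; rewrite ltnS ltnW.
  - by move: nU; have [->] := Kdisj Kp (ptK _).
  - by right; exists i => //; apply/DP.
(* [K (i, k)] is reserved for [k], hence untouched by the step for [i]. *)
have Vlo i k : (i < k)%N -> V i (pt (i, k)) <-> U i (pt (i, k)).
  move=> ik; split=> [[[]//|[j ji /DP[_ Kp]]]|Ui].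
    by move: ik; have [_ ->] := Kdisj Kp (ptK _); rewrite ltnn.
  left; split=> // -[j _ Kp].
  by move: ik; have [_ ->] := Kdisj Kp (ptK _); rewrite ltnn.
have Vneq i k : (i < k)%N -> V i <> V k.
  move=> ik e; have := Vlo _ _ ik; have := Vup _ _ ik; rewrite e => -> [].
  by have [Ui|nUi] := pselect (U i (pt (i, k))); [move=> _ /(_ Ui)|move=> /(_ nUi)].
exists V; split.
- move=> k; apply: CU; first by apply: CD => //; exact: Cbig.
  by apply: Cbig => i; rewrite /D; case: ifP.
- by move=> k VT; apply: (Vdiag k); rewrite VT.
- by move=> i k e; case: (ltngtP i k) => // /Vneq; rewrite e.
- move=> x; have [[[i k0] Kx]|nK] := pselect (exists p, K p x); last first.
    exists 0%N => k _; split=> [[[]//|[i _ /DP[_ Kx]]]|Ux].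
      by case: nK; exists (i, k).
    by left; split=> // -[i _ Kx]; case: nK; exists (i, k).
  exists k0 => k kk0; split=> [[[]//|[j _ /DP[_ Kx']]]|Ux].
    by case: kk0; have [] := Kdisj Kx' Kx.
  by left; split=> // -[j _ Kx']; case: kk0; have [] := Kdisj Kx' Kx.
Qed.

(** The sets given by [Psi] are made pairwise distinct over all rows and
    columns; a selection then determines the rows and columns it uses. Each
    point changes at one pair of indices only, and all the conditions in play
    ignore finitely many indices. *)
Lemma diag_of_S02 : S02 (countable_tau_covers C) (countable_tau_covers C) ->
  forall Psi : X -> cantor2, (forall p, C [set x | Psi x p = true]) ->
  tau_family (range Psi) -> semi_tau_diagonalizable (range Psi).
Proof.
move=> S Psi CPsi [Pinf Ptot].
have [V [CV VT Vinj VP]] : exists V : nat * nat -> set X,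
    [/\ forall p, C (V p), forall p, V p <> [set: X],
    injective V & forall x, exists q, forall p, p <> q -> V p x <-> Psi x p = true].
  pose U k := if (unpickle k : option (nat * nat)) is Some p
              then [set x | Psi x p = true] else set0.
  have [|V [CV VT Vinj VP]] := @disjointify U.
    by move=> k; rewrite /U; case: unpickle.
  exists (V \o pickle); split=> [p|p|p q /Vinj/(pcan_inj pickleK)//|x] //=.
  have [k0 k0P] := VP x; exists (odflt (0, 0)%N (unpickle k0)) => p pk0.
  rewrite /= k0P /U ?pickleK//= => pk; apply: pk0; by rewrite -pk pickleK.
(* The exceptional pair of [x] is avoided by a bound on either coordinate. *)
have Vfst x : exists N, forall p, (N <= p.1)%N -> V p x <-> Psi x p = true.
  have [q qP] := VP x; exists q.1.+1 => p; rewrite ltnNge => pq.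
  by apply: qP => pq'; rewrite pq' leqnn in pq.
have Vsnd x : exists N, forall p, (N <= p.2)%N -> V p x <-> Psi x p = true.
  have [q qP] := VP x; exists q.2.+1 => p; rewrite ltnNge => pq.
  by apply: qP => pq'; rewrite pq' leqnn in pq.
pose U n := [set V (n, m) | m in [set: nat]].
have Uinf n x : infinite_set [set A | U n A /\ A x].
  have [N NP] := Vsnd x.
  have /infinite_natP Pxinf := Pinf _ (imageT Psi x) n.
  apply: (@inj_infinite _ _ [set m | V (n, m) x] _ (fun m => V (n, m))).
  - by move=> m Vx; split => //; exists m.
  - by move=> m m' _ _ /Vinj[].
  apply/infinite_natP => N'; have [m] := Pxinf (maxn N N').
  by rewrite geq_max => /andP[Nm N'm] Pm; exists m => //; apply/NP.
have [|F [FU [Fcount _ [[[_ Fcov] Finf] Ftot]]]] := S U.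
  move=> n; split.
  - exact: card_image_le.
  - by move=> _ [m _ <-].
  split; first split => //; first split.
  - by move=> [m _ /VT].
  - apply/seteqP; split=> // x _.
    by have [A [UA Ax]] := infinite_setN0 (Uinf n x); exists A.
  have half u v : (\forall m \near \oo, (Psi u (n, m) <= Psi v (n, m))%N) ->
      finite_set [set A | [/\ U n A, A u & ~ A v]].
    move=> /near_natP[N NP]; have [Nu uP] := Vsnd u; have [Nv vP] := Vsnd v.
    apply: (@sub_finite_set _ _
      ((fun m => V (n, m)) @` [set m | V (n, m) u /\ ~ V (n, m) v])).
      by move=> _ [[m _ <-] mu mv]; exists m.
    apply: finite_image; apply: (@finite_leq _ (maxn N (maxn Nu Nv))) => m.
    rewrite !geq_max => /and3P[/NP/leq_boolP Nm num nvm] /= [/uP Vu Vv].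
    by apply: Vv; apply/vP => //; apply: Nm; exact: Vu.
  by move=> x y; have [/half|/half] := Ptot _ _ (imageT Psi x) (imageT Psi y) n;
    [left|right].
have [g gP] : exists g : nat -> option nat,
    forall n m, g n = Some m <-> F n (V (n, m)).
  have H n : exists o : option nat, forall m, o = Some m <-> F n (V (n, m)).
    have [_ /card_lt2P F1] := FU n.
    have [[m Fm]|nF] := pselect (exists m, F n (V (n, m))).
      exists (Some m) => m'; split=> [[<-]//|Fm'].
      by have /Vinj[->] := F1 _ _ Fm Fm'.
    by exists None => m; split=> // Fm; case: nF; exists m.
  have [g gP] := choice H; by exists g.
have FV A n : F n A -> exists2 m, g n = Some m & A = V (n, m).
  move=> FA; have [/(_ _ FA)[m _ AE] _] := FU n; exists m => //.
  by apply/gP; rewrite AE.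
exists g; split=> [_ [x _ <-]|_ _ [x _ <-] [y _ <-]].
  have [N NP] := Vfst x.
  have Sinf : infinite_set [set n | exists2 m, g n = Some m & V (n, m) x].
    move=> /(finite_image (fun n => V (n, odflt 0%N (g n)))).
    apply: sub_infinite_set (Finf x) => A [[n _ /FV[m gn ->]] Ax].
    by exists n; [exists m|rewrite gn].
  apply/infinite_natP => N'; move/infinite_natP: Sinf => /(_ (maxn N N')).
  move=> [n]; rewrite geq_max => /andP[Nn N'n] [m gn Vx]; exists n => //.
  by exists m => //; apply/NP.
have half u v : finite_set [set A | [/\ (\bigcup_n F n) A, A u & ~ A v]] ->
    \forall n \near \oo,
      forall m, g n = Some m -> (Psi u (n, m) <= Psi v (n, m))%N.
  move=> fin; have [Nu uP] := Vfst u; have [Nv vP] := Vfst v.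
  have /near_natP[N NP] : \forall n \near \oo,
      forall m, g n = Some m -> V (n, m) u -> V (n, m) v.
    apply/near_cofinite; apply: contrapT => Sinf; move: fin.
    apply: (inj_infinite _ _ Sinf (f := fun n => V (n, odflt 0%N (g n)))).
      move=> n /= /existsNP[m /not_implyP[gn /not_implyP[Vu nVv]]].
      by rewrite gn; split => //; exists n => //; exact/gP.
    by move=> n n' _ _ /Vinj[].
  apply/near_natP; exists (maxn N (maxn Nu Nv)) => n.
  rewrite !geq_max => /and3P[Nn nu nv] m gn; apply/leq_boolP => Pu.
  by apply/vP => //; apply: NP gn _ => //; exact/uP.
by have [/half|/half] := Ftot x y; [left|right].
Qed.

End Diagonalization.

(** * Functions into the Cantor space *)

(** The basic clopen neighbourhoods of [a] in the Cantor space, in a decreasing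
    sequence: only finitely many coordinates have a code below [N]. *)
Definition agree (N : nat) (a b : cantor2) : Prop :=
  forall p : nat * nat, (pickle p < N)%N -> a p = b p.

Lemma agreeC N a b : agree N a b -> agree N b a.
Proof. by move=> ab p /ab. Qed.

Lemma agree_trans N a b c : agree N a b -> agree N b c -> agree N a c.
Proof. by move=> ab bc p pN; rewrite ab// bc. Qed.

Lemma agree_le M N a b : (M <= N)%N -> agree N a b -> agree M a b.
Proof. by move=> MN ab p pM; apply: ab; exact: leq_trans MN. Qed.

Lemma agree_eq a b : (forall N, agree N a b) -> a = b.
Proof. by move=> ab; apply/funext => p; exact: (ab (pickle p).+1). Qed.

Lemma filter_agree (T : Type) (F : set_system T) (Psi : T -> cantor2)
    (a : cantor2) : Filter F -> (forall p, F [set y | a p = Psi y p]) ->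
  forall N, F [set y | agree N a (Psi y)].
Proof.
move=> FF Fp; elim=> [|N IH]; first by apply: filterS filterT => y _ p.
pose q : option (nat * nat) := unpickle N.
have Fq : F [set y | forall p, q = Some p -> a p = Psi y p].
  case: q => [p|]; last by apply: filterS filterT => y _ p.
  by apply: filterS (Fp p) => y ap _ [<-].
apply: filterS2 IH Fq => y yN yq p; rewrite ltnS leq_eqVlt => /predU1P[pN|/yN//].
by apply: yq; rewrite /q -pN pickleK.
Qed.

Lemma coord_continuous p : continuous (fun a : cantor2 => a p).
Proof. exact: (@proj_continuous _ (fun=> bool) p). Qed.

(** If the cylinders around [a] all left [O], a sequence of points outside [O],
    one from each cylinder, would converge to [a] pointwise. *)
Lemma nbhs_cantorP (a : cantor2) (O : set cantor2) :
  nbhs a O <-> exists N, forall b, agree N a b -> O b.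
Proof.
split=> [aO|[N NO]]; last first.
  have : nbhs a [set b | agree N a b]; last exact: filterS.
  apply: (@filter_agree _ (nbhs a) id) => p.
  apply: (@coord_continuous p a [set x | a p = x]).
  by apply: open_nbhs_nbhs; split => //; exact: discrete_open.
apply: contrapT => nO.
have H N : exists b, agree N a b /\ ~ O b.
  apply: contrapT => nb; apply: nO; exists N => b ab.
  by apply: contrapT => Ob; apply: nb; exists b.
have [u uP] := choice H.
have cvgu : {ptws, u @ \oo --> a}.
  apply/pointwise_cvgP => p; apply: cvg_near_cst.
  apply/near_natP; exists (pickle p).+1 => n pn.
  by have [/(_ p pn)] := uP n.
have /near_natP[N /(_ N (leqnn N))] := cvgu _ aO.
by have [] := uP N.
Qed.

Lemma clopen_coord p : clopen [set a : cantor2 | a p = true].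
Proof.
have cT : clopen [set true].
  by split; [exact: discrete_open|exact: discrete_closed].
exact: (preimage_clopen cT (@coord_continuous p)).
Qed.

Lemma continuous_coordP (X : topologicalType) (Psi : X -> cantor2) :
  continuous Psi <-> forall p, clopen [set x | Psi x p = true].
Proof.
split=> [cPsi p|clPsi x]; first exact: preimage_clopen (clopen_coord p) cPsi.
move=> O /nbhs_cantorP[N NO]; apply: (@filterS _ (nbhs x) _ _ _ (fun y => NO (Psi y))).
apply: filter_agree => p; have [op cl] := clPsi p.
have -> : [set y | Psi x p = Psi y p] = if Psi x p
    then [set y | Psi y p = true] else ~` [set y | Psi y p = true].
  by apply/seteqP; split => y /=; case: (Psi x p) => /=; case: (Psi y p).
case e : (Psi x p); apply: open_nbhs_nbhs; split => //=; last by rewrite e.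
exact: closed_openC.
Qed.

Section Borel.
Variable X : topologicalType.
Implicit Types A B : set X.

Lemma borel0 : borel (set0 : set X). Proof. exact: sigma_algebra0. Qed.

Lemma open_borel A : open A -> borel A. Proof. exact: sub_sigma_algebra. Qed.

Lemma borelC A : borel A -> borel (~` A).
Proof. by rewrite -setTD; exact: sigma_algebraCD. Qed.

Lemma borel_bigcup (S : countType) (P : set S) (F : S -> set X) :
  (forall s, P s -> borel (F s)) -> borel (\bigcup_(s in P) F s).
Proof.
move=> bF; pose G k := if (unpickle k : option S) is Some s
  then if `[< P s >] then F s else set0 else set0.
have -> : \bigcup_(s in P) F s = \bigcup_k G k.
  apply/seteqP; split=> [x [s Ps Fx]|x [k _]].
    by exists (pickle s) => //; rewrite /G pickleK asboolT.
  by rewrite /G; case: unpickle => // s; case: asboolP => // Ps Fx; exists s.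
apply: sigma_algebra_bigcup => k; rewrite /G.
case: unpickle => [s|]; last exact: borel0.
by case: asboolP => [|_]; [exact: bF|exact: borel0].
Qed.

Lemma borelU A B : borel A -> borel B -> borel (A `|` B).
Proof.
move=> bA bB.
rewrite (_ : _ `|` _ = \bigcup_(b in [set: bool]) if b then A else B).
  by apply: borel_bigcup => -[] _.
apply/seteqP; split=> x; first by case=> ?; [exists true|exists false].
by move=> [[] _]; [left|right].
Qed.

Lemma borelI A B : borel A -> borel B -> borel (A `&` B).
Proof.
move=> bA bB; rewrite -[A `&` B]setCK setCI; apply: borelC.
by apply: borelU; exact: borelC.
Qed.

Lemma borelD A B : borel A -> borel B -> borel (A `\` B).
Proof. by move=> bA bB; rewrite setDE; apply: borelI => //; exact: borelC. Qed.

End Borel.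

(** The point that begins with [s] and continues with [false]; it stands for the
    basic clopen set of the points that begin with [s]. *)
Definition word_point (s : seq bool) : cantor2 :=
  fun p => nth false s (pickle p).

Definition word (a : cantor2) N : seq bool :=
  mkseq (fun k => if unpickle k is Some p then a p else false) N.

Lemma agree_word a N : agree N a (word_point (word a N)).
Proof. by move=> p pN; rewrite /word_point nth_mkseq// pickleK. Qed.

Lemma size_word a N : size (word a N) = N.
Proof. by rewrite size_mkseq. Qed.

(** The Cantor space has a countable base, of the sets of all points that
    extend a given word, so that preimages of open sets are countable unions of
    preimages of basic sets. *)
Lemma borel_coordP (X : topologicalType) (Psi : X -> cantor2) :
  borel_fun Psi <-> forall p, borel [set x | Psi x p = true].
Proof.
split=> [bPsi p|bPsi].
  apply: (bPsi [set a | a p = true]); apply: open_borel.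
  by have [] := clopen_coord p.
have bagree (a : cantor2) N : borel [set x | agree N a (Psi x)].
  have -> : [set x | agree N a (Psi x)] = ~` \bigcup_(p in [set p | (pickle p < N)%N])
     (if a p then ~` [set x | Psi x p = true] else [set x | Psi x p = true]).
    apply/seteqP; split=> x /=.
      by move=> ax [p pN]; rewrite (ax p pN); case e : (Psi x p) => //=; rewrite e.
    move=> nx p pN; apply: contrapT => ne; apply: nx; exists p => //.
    by case: (a p) ne => /=; case: (Psi x p).
  apply: borelC; apply: borel_bigcup => p _; case: (a p) => //; exact: borelC.
suff sub : @borel cantor2 `<=` [set B : set cantor2 | borel (Psi @^-1` B)].
  by move=> B /sub.
apply: smallest_sub.
  split; first by rewrite /= preimage_set0; exact: borel0.
    by move=> A bA /=; rewrite setTD preimage_setC; exact: borelC.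
  move=> A bA /=; rewrite preimage_bigcup.
  by apply: (@borel_bigcup _ nat) => n _; exact: bA.
move=> O oO /=.
pose P := [set s | forall b, agree (size s) (word_point s) b -> O b].
have -> : Psi @^-1` O =
    \bigcup_(s in P) [set x | agree (size s) (word_point s) (Psi x)].
  apply/seteqP; split=> x /=; last by move=> [s Ps]; exact: Ps.
  move=> Ox; have /nbhs_cantorP[N NO] : nbhs (Psi x) O by apply: open_nbhs_nbhs; split.
  exists (word (Psi x) N) => /=; rewrite /P /= size_word;
    last exact/agreeC/agree_word.
  by move=> b wb; apply: NO; apply: agree_trans wb; exact: agree_word.
by apply: borel_bigcup.
Qed.

(** * Selection properties of a set of reals *)

Lemma clopenD (X : topologicalType) (A B : set X) :
  clopen A -> clopen B -> clopen (A `\` B).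
Proof. by move=> cA cB; rewrite setDE; apply: clopenI => //; exact: clopenC. Qed.

Lemma metrizable_separated (R : realType) (X : topologicalType) (x y : X) :
  metrizable R X -> clopen_base X -> x <> y ->
  exists V : set X, [/\ clopen V, V x & ~ V y].
Proof.
move=> [d [d0 dC dtri dnbhs]] base xy.
have dxy : (0 < d x y)%R.
  have : (0 <= d x y)%R.
    have := dtri x y x; rewrite (dC y x) (d0 x x).2//.
    by rewrite -mulr2n pmulrn_lge0.
  by rewrite le_eqVlt => /predU1P[/esym/d0//|].
have [|V [cV Vx Vsub]] := base x [set z | (d x z < d x y)%R].
  by apply/dnbhs; exists (d x y).
by exists V; split=> // /Vsub /=; rewrite ltxx.
Qed.

(** An infinite clopen set [Y] can be cut into two nonempty clopen parts by
    separating two of its points, and one part is infinite. Iterating on the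
    infinite part, the discarded parts are disjoint. *)
Lemma disjoint_clopens (R : realType) (X : topologicalType) : set_of_reals R X ->
  exists K : nat * nat -> set X, [/\ forall p, clopen (K p),
    forall p, K p !=set0 & forall p q x, K p x -> K q x -> p = q].
Proof.
move=> [Xinf base _ metr].
have H (Y : set X) : exists Z, infinite_set Y -> clopen Y ->
    [/\ infinite_set Z, clopen Z, Z `<=` Y & Y `\` Z !=set0].
  have [[Yinf cY]|nY] := pselect (infinite_set Y /\ clopen Y); last first.
    by exists set0 => Yinf cY; case: nY.
  have [x Yx] := infinite_setN0 Yinf.
  have [y [Yy xy]] : exists y, Y y /\ x <> y.
    apply: contra_notP Yinf => nex; apply: (@sub_finite_set _ _ [set x]) => //.
    by move=> z Yz; apply: contrapT => xz; apply: nex; exists z; split=> // /esym.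
  have [V [cV Vx nVy]] := metrizable_separated metr base xy.
  have [fin|inf] := pselect (finite_set (Y `&` V)).
    exists (Y `\` V) => _ _; split=> //; last by exists x; split => // -[].
    - by move=> fin'; apply: Yinf; rewrite -(setUIDK Y V) finite_setU.
    - exact: clopenD.
  exists (Y `&` V) => _ _; split=> //; last by exists y; split => // -[].
  exact: clopenI.
have [f fP] := choice H.
pose Y n := iter n f [set: X].
have YP n : infinite_set (Y n) /\ clopen (Y n).
  elim: n => [|n [Yinf cY]]; first by split => //; exact: clopenT.
  by have [] := fP _ Yinf cY.
have Ysub m n : (m <= n)%N -> Y n `<=` Y m.
  move=> /subnK <-; elim: (n - m)%N => // k IH; apply: subset_trans IH.
  by have [Yinf cY] := YP (k + m)%N; have [] := fP _ Yinf cY.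
exists (fun p => Y (pickle p) `\` Y (pickle p).+1); split.
- move=> p; apply: clopenD; first by have [] := YP (pickle p).
  by have [] := YP (pickle p).+1.
- by move=> p; have [Yinf cY] := YP (pickle p); have [] := fP _ Yinf cY.
- move=> p q x [Yp nYp] [Yq nYq]; apply: (pcan_inj pickleK).
  case: (ltngtP (pickle p) (pickle q)) => // /Ysub.
    by move=> /(_ _ Yq).
  by move=> /(_ _ Yp).
Qed.

Lemma S02_borel_iff (R : realType) (X : topologicalType) : set_of_reals R X ->
  S02 (BT X) (BT X) <-> forall Psi : X -> cantor2, borel_fun Psi ->
    tau_family (range Psi) -> semi_tau_diagonalizable (range Psi).
Proof.
move=> XR; have [Xinf _ _ _] := XR; have [x0 _] := infinite_setN0 Xinf.
have [K [cK K0 Kdisj]] := disjoint_clopens XR.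
split=> [S Psi /borel_coordP|H].
  apply: (diag_of_S02 _ _ _ _ K0 Kdisj S).
  - exact: borel0.
  - exact: borelD.
  - exact: borelU.
  - by move=> p; apply: open_borel; have [] := cK p.
apply: (S02_of_diag x0); first exact: borel0.
by move=> Psi /borel_coordP; exact: H.
Qed.

Lemma S02_clopen_iff (R : realType) (X : topologicalType) : set_of_reals R X ->
  S02 (CT X) (CT X) <-> forall Psi : X -> cantor2, continuous Psi ->
    tau_family (range Psi) -> semi_tau_diagonalizable (range Psi).
Proof.
move=> XR; have [Xinf _ _ _] := XR; have [x0 _] := infinite_setN0 Xinf.
have [K [cK K0 Kdisj]] := disjoint_clopens XR.
split=> [S Psi /continuous_coordP|H].
  apply: (diag_of_S02 _ _ _ cK K0 Kdisj S).
  - exact: clopen0.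
  - exact: clopenD.
  - by move=> A B; exact: clopenU.
apply: (S02_of_diag x0); first exact: clopen0.
by move=> Psi /continuous_coordP; exact: H.
Qed.

Lemma S02_sub (X : Type) (C C' : set (set X)) : C `<=` C' ->
  S02 (countable_tau_covers C') (countable_tau_covers C') ->
  S02 (countable_tau_covers C) (countable_tau_covers C).
Proof.
move=> CC' S U UC; have [|F [FU [Fc _ Ft]]] := S U.
  by move=> n; have [Uc UsubC Ut] := UC n; split=> // A /UsubC /CC'.
exists F; split=> //; split=> // A [n _ FA].
by have [_ + _] := UC n; apply; have [+ _] := FU n; apply.
Qed.

Lemma S02_borel_open (X : topologicalType) :
  S02 (BT X) (BT X) -> S02 (OT X) (OT X).
Proof. by apply: S02_sub => A; exact: open_borel. Qed.

Lemma S02_open_clopen (X : topologicalType) :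
  S02 (OT X) (OT X) -> S02 (CT X) (CT X).
Proof. by apply: S02_sub => A []. Qed.

(** * Families as sets of reals *)

Section Subspace.
Variables (R : realType) (A : set cantor2).

Definition subspace_top : topologicalType := initial_topology (@set_val _ A).
Local Notation X := subspace_top.
Definition subval (x : X) : cantor2 := @set_val _ A x.
Local Notation f := subval.

Lemma subval_inj : injective f. Proof. exact: val_inj. Qed.

Lemma range_subval : range f = A.
Proof.
apply/seteqP; split=> [_ [x _ <-]|a Aa]; first exact: set_valP.
by exists (SigSub (mem_set Aa)).
Qed.

Lemma card_subspace : [set: X] #= A.
Proof. exact: card_setT. Qed.

Lemma continuous_subval : continuous f.
Proof. exact: (@initial_continuous _ _ (@set_val _ A)). Qed.

(** Both the clopen base and the metric come from this description. *)
Lemma nbhs_subP (x : X) (B : set X) :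
  nbhs x B <-> exists N, forall y, agree N (f x) (f y) -> B y.
Proof.
split=> [[_ [[G oG <-] Gx GB]]|[N NB]]; last first.
  apply: (@filterS _ (nbhs x) _ _ _ NB); apply: continuous_subval.
  by apply/(nbhs_cantorP (f x) [set b | agree N (f x) b]); exists N.
have /nbhs_cantorP[N NG] : nbhs (f x) G by apply: open_nbhs_nbhs; split.
by exists N => y xy; apply: GB; exact: NG.
Qed.

Lemma clopen_agree N (x : X) : clopen [set y : X | agree N (f x) (f y)].
Proof.
split; last rewrite -openC; rewrite openE => y /= xy; apply/nbhs_subP;
  exists N => z yz.
  exact: agree_trans yz.
by move=> xz; apply: xy; apply: agree_trans xz _; exact: agreeC.
Qed.

Lemma clopen_base_sub : clopen_base X.
Proof.
move=> x B /nbhs_subP[N NB]; exists [set y : X | agree N (f x) (f y)].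
by split=> //; exact: clopen_agree.
Qed.

(** One point is chosen in every nonempty basic clopen set. *)
Lemma separable_sub (x0 : X) : separable_space X.
Proof.
have H (s : seq bool) : exists x : X,
    forall y, agree (size s) (f y) (word_point s) ->
      agree (size s) (f x) (word_point s).
  have [[x xs]|nx] :=
      pselect (exists x : X, agree (size s) (f x) (word_point s)).
    by exists x.
  by exists x0 => y ys; case: nx; exists y.
have [pt ptP] := choice H; exists (range pt).
  by apply: (card_le_trans (card_image_le _ _)); exact: countableP.
move=> O [x Ox] oO; have /nbhs_subP[N NO] : nbhs x O by apply: open_nbhs_nbhs; split.
have := ptP (word (f x) N) x; rewrite size_word.
move=> /(_ (@agree_word _ _)) xw.
exists (pt (word (f x) N)); split; last by exists (word (f x) N).
apply: NO; apply: agree_trans (@agree_word _ _) _; exact: agreeC.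
Qed.

(** The distance is the inverse of the first [N] at which the two points do not
    agree. It only depends on the agreement of the points, which is transitive
    for each [N]; so it is an ultrametric. *)
Lemma metrizable_sub : metrizable R X.
Proof.
have H (p : X * X) : exists r : R, (r = 0%R /\ p.1 = p.2) \/
    (exists m, [/\ r = (m.+1%:R^-1)%R, agree m (f p.1) (f p.2)
       & ~ agree m.+1 (f p.1) (f p.2)]).
  have [[N nN]|all] := pselect (exists N, ~ agree N (f p.1) (f p.2)).
    have exN : exists N, ~~ `[< agree N (f p.1) (f p.2) >].
      by exists N; apply/asboolPn.
    have [m /asboolPn nm mmin] := ex_minnP exN.
    case: m => [|m] in nm mmin *; first by case: nm => q.
    exists (m.+1%:R^-1)%R; right; exists m; split=> //.
    apply: contrapT => /asboolPn /mmin; by rewrite ltnn.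
  exists 0%R; left; split=> //; apply: subval_inj; apply: agree_eq => N.
  by apply: contrapT => nN; apply: all; exists N.
have [d' dP'] := choice H.
pose d x y := d' (x, y).
have dP x y : (d x y = 0%R /\ x = y) \/
    (exists m, [/\ d x y = (m.+1%:R^-1)%R, agree m (f x) (f y)
       & ~ agree m.+1 (f x) (f y)]).
  exact: (dP' (x, y)).
have inv_le m n : (m.+1%:R^-1 <= n.+1%:R^-1 :> R)%R = (n <= m)%N.
  by rewrite lef_pV2 ?posrE ?ltr0Sn// ler_nat.
have d_ge0 x y : (0 <= d x y)%R.
  by have [[-> _]|[m [-> _ _]]] := dP x y; rewrite ?invr_ge0 ?ler0n.
have d_lt N x y : agree N.+1 (f x) (f y) -> (d x y < N.+1%:R^-1)%R.
  have [[-> _]|[m [-> _ nm]]] := dP x y; first by rewrite invr_gt0 ltr0Sn.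
  move=> agN; rewrite ltNge inv_le; apply/negP => mN.
  by apply: nm; apply: agree_le agN.
have d_ge N x y : ~ agree N.+1 (f x) (f y) -> (N.+1%:R^-1 <= d x y)%R.
  have [[_ ->]|[m [-> am _]]] := dP x y; first by case.
  rewrite inv_le => nN; rewrite leqNgt; apply/negP => Nm.
  by apply: nN; apply: agree_le am.
have d_le x y u v : (forall N, agree N (f u) (f v) -> agree N (f x) (f y)) ->
    (d x y <= d u v)%R.
  move=> uvxy; have [[-> _]|[m [-> _ nm]]] := dP x y; first exact: d_ge0.
  by apply: d_ge => /uvxy.
exists d; split.
- move=> x y; split=> [dxy|->]; last first.
    by have [[->]//|[m [_ _ []]]] := dP y y.
  have [[_ ->]//|[m [dm _ _]]] := dP x y.
  by move: dxy; rewrite dm => /eqP; rewrite invr_eq0 pnatr_eq0.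
- by move=> x y; apply/eqP; rewrite eq_le !d_le// => N; exact: agreeC.
- move=> x y z; have [[-> _]|[m [-> _ nm]]] := dP x z; first exact: addr_ge0.
  have [xy|nxy] := pselect (agree m.+1 (f x) (f y)).
    apply: ler_wpDl => //; apply: d_ge => yz; apply: nm; exact: agree_trans yz.
  by apply: ler_wpDr => //; exact: d_ge.
- move=> x B; split=> [/nbhs_subP[N NB]|[e e0 eB]].
    exists (N.+1%:R^-1)%R; first by rewrite invr_gt0 ltr0Sn.
    move=> y /= dxy; apply: NB; apply: (@agree_le _ N.+1) => //.
    by apply: contrapT => /d_ge; rewrite leNgt dxy.
  have /near_natP[N /(_ N (leqnn N)) Ne] := near_infty_natSinv_lt (PosNum e0).
  apply/nbhs_subP; exists N.+1 => y /d_lt dN; apply: eB => /=.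
  exact: lt_trans dN Ne.
Qed.

Lemma set_of_reals_sub : infinite_set A -> set_of_reals R X.
Proof.
move=> Ainf; have Xinf : infinite_set [set: X].
  move=> Xfin; apply: Ainf; apply: card_le_finite Xfin.
  by rewrite (card_le_eqr card_subspace) card_lexx.
have [x0 _] := infinite_setN0 Xinf.
by split; [|exact: clopen_base_sub|exact: separable_sub x0|exact: metrizable_sub].
Qed.

End Subspace.

(** The inclusion of [A] in the Cantor space is a continuous map with range
    [A]. The family is infinite, as sets of reals must be, because finite
    tau-families are diagonalizable. *)
Lemma witness_space (R : realType) (A : set cantor2) :
  tau_family A -> ~ semi_tau_diagonalizable A ->
  exists X : topologicalType,
    [/\ set_of_reals R X, ~ S02 (CT X) (CT X) & [set: X] #= A].
Proof.
move=> tA nA; have Ainf : infinite_set A by move=> /finite_tau_family_diag /(_ tA).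
have XR := set_of_reals_sub R Ainf.
exists (subspace_top A); split => //; last exact: card_subspace.
move=> /(S02_clopen_iff XR)/(_ (@subval A) (@continuous_subval A)).
by rewrite range_subval => /(_ tA).
Qed.

(** A semi tau-diagonalization, completed to a total function, meets every
    member. So if all tau-families have one, then od has no witness, and its
    value is the empty type. *)
Lemma min3_le_of_diag (B : Type) (S : set B) :
  (forall A : set cantor2, tau_family A -> semi_tau_diagonalizable A) ->
  [set: min3_card splitting_number bounding_number od_number] #<= S.
Proof.
move=> diag; apply: (@min3_card_le _ _ _ od_number); first by constructor 3.
apply: min_card_empty => K [A [tA nA] _]; apply: nA.
have [g [ginf _]] := diag _ tA.
exists (fun n => odflt 0%N (g n)) => a Aa.
by have [n [m gn am]] := infinite_setN0 (ginf _ Aa); exists n; rewrite gn /=.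
Qed.

Lemma min3_le_family (A : set cantor2) :
  tau_family A -> ~ semi_tau_diagonalizable A ->
  [set: min3_card splitting_number bounding_number od_number] #<= A.
Proof.
by move=> tA nA; apply: contrapT => /(small_tau_family_diag tA).
Qed.

Theorem theorem2p3 (R : realType) :
  [/\ (forall X : topologicalType, set_of_reals R X ->
         (S02 (BT X) (BT X) <->
            forall Psi : X -> cantor2, borel_fun Psi ->
              tau_family (range Psi) -> semi_tau_diagonalizable (range Psi)) /\
         (S02 (CT X) (CT X) <->
            forall Psi : X -> cantor2, continuous Psi ->
              tau_family (range Psi) -> semi_tau_diagonalizable (range Psi))),
      [set: min3_card splitting_number bounding_number od_number] #<=
        [set: min_size (fun A : set cantor2 =>
                tau_family A /\ ~ semi_tau_diagonalizable A)]
    & [/\ [set: min3_card splitting_number bounding_number od_number] #<=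
            [set: non R (fun X => S02 (BT X) (BT X))],
          [set: non R (fun X => S02 (BT X) (BT X))] #=
            [set: non R (fun X => S02 (OT X) (OT X))]
        & [set: non R (fun X => S02 (OT X) (OT X))] #=
            [set: non R (fun X => S02 (CT X) (CT X))]]].
Proof.
have borel_clopen X : set_of_reals R X -> ~ S02 (BT X) (BT X) ->
    exists A : set cantor2, [/\ tau_family A, ~ semi_tau_diagonalizable A
      & A #<= [set: X]].
  move=> XR; rewrite (S02_borel_iff XR) => /existsNP[Psi].
  move=> /not_implyP[_ /not_implyP[tau nsemi]].
  by exists (range Psi); split=> //; exact: card_image_le.
have back X : set_of_reals R X -> ~ S02 (BT X) (BT X) ->
    exists Y : topologicalType,
      [/\ set_of_reals R Y, ~ S02 (CT Y) (CT Y) & [set: Y] #<= [set: X]].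
  move=> XR /(borel_clopen _ XR)[A [tA nA AX]].
  have [Y [YR nY YA]] := witness_space R tA nA.
  by exists Y; split=> //; rewrite (card_le_eql YA).
split; last split.
- by move=> X XR; split; [exact: S02_borel_iff XR|exact: S02_clopen_iff XR].
- have [[A [tA nA]]|nA] :=
      pselect (exists A, tau_family A /\ ~ semi_tau_diagonalizable A).
    have [B [tB nB] BE] := min_size_attained
      (Q := fun A => tau_family A /\ ~ semi_tau_diagonalizable A) (conj tA nA).
    by rewrite -(card_le_eqr BE); exact: min3_le_family.
  apply: min3_le_of_diag => A tA; apply: contrapT => nsA; apply: nA.
  by exists A.
- have [[X [XR nX]]|nX] := pselect (exists X : topologicalType,
      set_of_reals R X /\ ~ S02 (BT X) (BT X)).
    have [Z [ZR nZ ZE]] := non_attained (P := fun X => S02 (BT X) (BT X)) XR nX.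
    rewrite -(card_le_eqr ZE); have [A [tA nA AZ]] := borel_clopen Z ZR nZ.
    by apply: card_le_trans AZ; exact: min3_le_family.
  apply: min3_le_of_diag => A tA; apply: contrapT => nsA; apply: nX.
  have [Y [YR nY _]] := witness_space R tA nsA.
  by exists Y; split=> // /S02_borel_open/S02_open_clopen.
- apply: non_eq => X XR.
    by move=> /(back _ XR)[Y [YR nY YX]]; exists Y; split=> // /S02_open_clopen.
  by move=> nX; exists X; split=> [//|/S02_borel_open//|]; exact: card_lexx.
- apply: non_eq => X XR.
    by move=> nX; apply: back => // /S02_borel_open.
  by move=> nX; exists X; split=> [//|/S02_open_clopen//|]; exact: card_lexx.
Qed.
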